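(* Let $t\geq 2$ be an integer. If $G$ is a connected $K_{3,t}$-minor-free graph, then $c(G)\leq t$.
   Context: All graphs are finite and simple. $K_{s,t}$ is the complete bipartite graph with parts of sizes $s$ and $t$. A graph $G$ is $H$-minor-free if no graph isomorphic to $H$ can be obtained from $G$ by deleting vertices, deleting edges and contracting edges. Cop number: in the game of cops and robbers on $G$, one player places $m$ cops on (not necessarily distinct) vertices, then the other player places the robber on a vertex. Then, starting with the cops, the players alternate turns; on a turn, a player may move any of their pieces to an adjacent vertex (each piece moves at most once, and any piece may stay put). The cops win if at some point some cop occupies the same vertex as the robber; the robber wins by evading capture forever. The cop number $c(G)$ is the minimum $m$ such that the cops have a winning strategy. *)

(* Defs.v *)
From mathcomp Require Import all_boot.
From mathcomp Require Import boolp.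

Set Implicit Arguments.
Unset Strict Implicit.
Unset Printing Implicit Defensive.

Record sgraph := SGraph {
  vertex :> finType;
  edge : rel vertex;
  edge_sym : symmetric edge;
  edge_irrefl : irreflexive edge }.

Arguments edge {s}.
Arguments SGraph {vertex edge}.

(* The graph without vertices also satisfies this predicate. *)
Definition connected_graph (G : sgraph) : Prop :=
  forall x y : G, connect edge x y.

Definition isomorphic (G H : sgraph) : Prop :=
  exists2 f : G -> H, bijective f & forall x y, edge (f x) (f y) = edge x y.

Section CompleteBipartite.
Variables s t : nat.

Definition Kst_rel : rel ('I_s + 'I_t) := fun x y =>
  match x, y with
  | inl _, inr _ | inr _, inl _ => true
  | _, _ => false
  end.

Lemma Kst_sym : symmetric Kst_rel. Proof. by case=> ? []. Qed.
Lemma Kst_irrefl : irreflexive Kst_rel. Proof. by case. Qed.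

Definition complete_bipartite : sgraph := SGraph Kst_sym Kst_irrefl.
End CompleteBipartite.

Section MinorOperations.
Variable G : sgraph.

Section DeleteVertex.
Variable v : G.

Definition del_vertex_rel : rel {x : G | x != v} :=
  fun x y => edge (val x) (val y).

Lemma del_vertex_sym : symmetric del_vertex_rel.
Proof. by move=> x y; apply: edge_sym. Qed.
Lemma del_vertex_irrefl : irreflexive del_vertex_rel.
Proof. by move=> x; apply: edge_irrefl. Qed.

Definition del_vertex : sgraph := SGraph del_vertex_sym del_vertex_irrefl.
End DeleteVertex.

Variables u v : G.

Definition del_edge_rel : rel G :=
  fun x y => edge x y && ([set x; y] != [set u; v]).

Lemma del_edge_sym : symmetric del_edge_rel.
Proof. by move=> x y; rewrite /del_edge_rel edge_sym setUC. Qed.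
Lemma del_edge_irrefl : irreflexive del_edge_rel.
Proof. by move=> x; rewrite /del_edge_rel edge_irrefl. Qed.

Definition del_edge : sgraph := SGraph del_edge_sym del_edge_irrefl.

(* Contracting uv removes v and lets u, standing for the merged vertex,
   inherit the neighbours of v; x != y discards the resulting loop. *)
Definition contract_rel : rel {x : G | x != v} := fun x y =>
  (x != y) && [|| edge (val x) (val y),
                  (val x == u) && edge v (val y)
                | (val y == u) && edge v (val x)].

Lemma contract_sym : symmetric contract_rel.
Proof.
move=> x y; rewrite /contract_rel eq_sym edge_sym; congr (_ && (_ || _)).
exact: orbC.
Qed.
Lemma contract_irrefl : irreflexive contract_rel.
Proof. by move=> x; rewrite /contract_rel eqxx. Qed.

Definition contract : sgraph := SGraph contract_sym contract_irrefl.
End MinorOperations.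

Inductive minor (H : sgraph) : sgraph -> Prop :=
| minor_iso (G : sgraph) : isomorphic H G -> minor H G
| minor_del_vertex (G : sgraph) (v : G) : minor H (del_vertex v) -> minor H G
| minor_del_edge (G : sgraph) (u v : G) :
    edge u v -> minor H (del_edge u v) -> minor H G
| minor_contract (G : sgraph) (u v : G) :
    edge u v -> minor H (contract u v) -> minor H G.

Definition minor_free (H G : sgraph) : Prop := ~ minor H G.

Section CopsAndRobbers.
Variable G : sgraph.

Definition legal_move (x y : G) : bool := (x == y) || edge x y.

(* r 0 is the initial position of the robber and r i its position after its
   i-th move. *)
Definition robber_play (r : nat -> G) : Prop :=
  forall i, legal_move (r i) (r i.+1).

(* A strategy maps the successive robber positions seen so far to the positions
   of the m cops; its value at [::] is the initial placement. *)
Definition cop_strategy (m : nat) : Type := seq G -> 'I_m -> G.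

(* Cop positions after their i-th move, which takes place when the robber has
   occupied r 0, ..., r (i - 1). *)
Definition cops_at m (sigma : cop_strategy m) (r : nat -> G) (i : nat) :
  'I_m -> G := sigma (mkseq r i).

Definition legal_strategy m (sigma : cop_strategy m) : Prop :=
  forall r, robber_play r ->
  forall i j, legal_move (cops_at sigma r i j) (cops_at sigma r i.+1 j).

(* The robber is at r i both just before and just after the (i+1)-th move of
   the cops, so capture may happen in either of these two positions. *)
Definition captured m (sigma : cop_strategy m) (r : nat -> G) : Prop :=
  exists i j, cops_at sigma r i j = r i \/ cops_at sigma r i.+1 j = r i.

Definition cops_win (m : nat) : Prop :=
  exists2 sigma : cop_strategy m, legal_strategy sigma &
    forall r, robber_play r -> captured sigma r.

Lemma cops_win_exists : exists m, `[< cops_win m >].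
Proof.
exists #|G|; apply/asboolP; exists (fun _ j => enum_val j).
  by move=> r _ i j; rewrite /legal_move eqxx.
by move=> r _; exists 0, (enum_rank (r 0)); left; apply: enum_rankK.
Qed.

Definition cop_number : nat := ex_minn cops_win_exists.

Lemma cop_numberP :
  cops_win cop_number /\ forall m, cops_win m -> cop_number <= m.
Proof.
rewrite /cop_number; case: ex_minnP => n /asboolP win_n min_n.
by split=> // m win_m; apply/min_n/asboolP.
Qed.
End CopsAndRobbers.

(* Main.v *)
Require Import Defs.
From mathcomp Require Import all_boot.
From mathcomp Require Import boolp zify.

Set Implicit Arguments.
Unset Strict Implicit.
Unset Printing Implicit Defensive.

(* Call R the connected region to which the robber is confined. The cops keep
   its boundary N(R) covered by k strands: paths T_i, each with a cop guarding its
   vertices in N(R), that lead from a connected set A to a connected set B, where A and B have no neighbour in R. The strands are disjoint except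
   that some of them may share a common first vertex a, and some a common last
   vertex b. Drop a strand that has no vertex of N(R) of its own, and move ends of
   strands outside N(R) into A or B: then the ends of the strands lie in N(R). If
   k = t, then R, A and B (with a and b added when shared) on one side and the t
   strands on the other form a K_{3,t}-minor. If k < t, a free cop guards a shortest
   path through R from the first vertex of a strand to the last vertex of a strand;
   this path is a new strand and R shrinks. *)

(** * Connectivity by cuts, neighbourhoods and components *)

Section Connectivity.
Variable G : sgraph.
Implicit Types (x y : G) (S : {set G}) (s : seq G).

(* Connectivity is stated by cuts, a form that pulls back along contractions
   and holds for the empty set. *)
Definition conn S := forall P : pred G,
  (exists2 x, x \in S & P x) -> (exists2 y, y \in S & ~~ P y) ->
  exists x y, [/\ x \in S, y \in S, P x, ~~ P y & edge x y].

Lemma conn0 : conn set0.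
Proof. by move=> P [x]; rewrite inE. Qed.

(** A cut of the larger set either splits [S], or separates [x] from all of [S] and is then crossed
    by the edge joining [u] to [x]. *)
Lemma connU1 x S : conn S -> S = set0 \/ (exists2 u, u \in S & edge u x) ->
  conn (x |: S).
Proof.
move=> cS aS P [y yS Py] [z zS Pz].
have [[u uS Pu]|noP] := EM (exists2 u, u \in S & P u); last first.
  have {}noP u : u \in S -> ~~ P u by move=> uS; apply/negP=> Pu; case: noP; exists u.
  have Px : P x.
    by case/setU1P: yS Py => [->|/noP/negPf->].
  case/setU1P: zS Pz => [->|zS Pz]; first by rewrite Px.
  case: aS => [S0|[u uS eux]]; first by rewrite S0 inE in zS.
  by exists x, u; split; rewrite ?setU11 ?setU1r // 1?edge_sym ?noP.
have [[v vS Pv]|noN] := EM (exists2 v, v \in S & ~~ P v).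
  have [||y' [z' [y'S z'S Py' Pz' e]]] := cS P; [by exists u|by exists v|].
  by exists y', z'; split; rewrite ?setU1r.
have {}noN v : v \in S -> P v by move=> vS; apply/negPn/negP=> Pv; case: noN; exists v.
have Px : ~~ P x by case/setU1P: zS Pz => [->|/noN->].
case: aS => [S0|[w wS ewx]]; first by rewrite S0 inE in uS.
by exists w, x; split; rewrite ?setU11 ?setU1r //; apply: noN.
Qed.

Lemma conn_path s : sorted edge s -> conn [set x in s].
Proof.
elim: s => [|x s IHs] /=; first by move=> _; rewrite set_nil; apply: conn0.
move=> xs; rewrite set_cons; apply: connU1; first exact/IHs/(path_sorted xs).
case: s xs {IHs} => [|y s] /=; first by rewrite set_nil; left.
by case/andP=> exy _; right; exists y; rewrite ?inE ?eqxx // edge_sym.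
Qed.

Lemma connT : connected_graph G -> conn [set: G].
Proof.
move=> cG P [x _ Px] [y _ Py].
have /connectP[s] := cG x y.
elim: s x Px => [|z s IHs] x Px /= => [_ yx|/andP[exz zs] ylast].
  by rewrite yx Px in Py.
have [Pz|Pz] := boolP (P z); first exact: IHs zs ylast.
by exists x, z; rewrite !inE.
Qed.

Definition nbrs S : {set G} := [set x | (x \notin S) && [exists y in S, edge y x]].

Lemma nbrsP S x : reflect (x \notin S /\ exists2 y, y \in S & edge y x) (x \in nbrs S).
Proof.
by rewrite inE; apply: (iffP andP) => [[? /exists_inP]|[? /exists_inP]].
Qed.

(** Take [C] of maximum size among the connected subsets of [S] containing [x]: a neighbour of [C]
    in [S] could be added to it. *)
Lemma component x S : x \in S -> exists C : {set G},
  [/\ conn C, x \in C, C \subset S & [disjoint nbrs C & S]].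
Proof.
move=> xS; pose P n := `[< exists C : {set G},
  [/\ conn C, x \in C, C \subset S & #|C| = n] >].
have exP : exists n, P n.
  exists #|[set x]|; apply/asboolP; exists [set x]; split; rewrite ?set11 ?sub1set //.
  by rewrite -[[set x]]setU0; apply: connU1; [apply: conn0|left].
have bP n : P n -> n <= #|S| by case/asboolP=> C [_ _ /subset_leq_card + <-].
case: (ex_maxnP exP bP) => n /asboolP[C [cC xC CS <-]] maxC.
exists C; split=> //; rewrite disjoint_subset; apply/subsetP=> y /nbrsP[yC [z zC ezy]].
apply/negP=> yS; have : P #|y |: C|.
  apply/asboolP; exists (y |: C); split; rewrite ?setU1r // ?subUset ?sub1set ?yS //.
  by apply: connU1 => //; right; exists z.
by move/maxC; rewrite cardsU1 yC ltnn.
Qed.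
End Connectivity.

(** * From branch sets to minors *)

Section Models.
Variable H : sgraph.

(** Edges of [G] that do not come from [H] are deleted one at a time, by induction on their number,
    until [f] is an isomorphism. *)
Lemma minor_spanning (G : sgraph) (f : H -> G) : bijective f ->
  (forall x y, edge x y -> edge (f x) (f y)) -> minor H G.
Proof.
have [n] := ubnP #|[set p : G * G | edge p.1 p.2]|.
elim: n G f => // n IHn G f leG bij_f hom_f.
have [/existsP[x /existsP[y /andP[efxy exy]]]|] :=
  boolP [exists x, exists y, edge (f x) (f y) && ~~ edge x y]; last first.
  move=> noxy; apply: minor_iso; exists f => // x y.
  apply/idP/idP=> [efxy|]; last exact: hom_f.
  by apply: contraNT noxy => exy; apply/existsP; exists x; apply/existsP; exists y; apply/andP.
apply: (minor_del_edge efxy); apply: (IHn (del_edge (f x) (f y)) f) => // [|x' y' exy'].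
  apply: leq_trans (leG : _ <= n); apply: proper_card; apply/properP.
  split; first by apply/subsetP=> p; rewrite !inE => /andP[].
  by exists (f x, f y); rewrite !inE //= /edge /= /del_edge_rel eqxx andbF.
rewrite /edge /= /del_edge_rel hom_f //=; apply: contraNneq exy => /setP eqxy.
have fi := bij_inj bij_f.
have := eqxy (f x'); have := eqxy (f y'); rewrite !inE !(inj_eq fi) !eqxx orbT /=.
case: (eqVneq x' y') exy' => [->|]; first by rewrite edge_irrefl.
move=> ne exy' /esym/orP[]/eqP yE /esym/orP[]/eqP xE; subst; rewrite ?eqxx // in ne *.
by rewrite edge_sym.
Qed.

(** These are the branch sets of an [H]-minor; they need not cover [G]. *)
Definition model (G : sgraph) (V : H -> {set G}) := [/\
  forall h, exists x, x \in V h,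
  forall h k x, x \in V h -> x \in V k -> h = k,
  forall h, conn (V h) &
  forall h k, edge h k -> exists x y, [/\ x \in V h, y \in V k & edge x y]].

Lemma model_del_vertex (G : sgraph) (V : H -> {set G}) (v : G) :
  (forall h, v \notin V h) -> model V ->
  model (fun h => [set x : del_vertex v | val x \in V h]).
Proof.
move=> vV [V0 Vd Vc Ve].
have neq h x : x \in V h -> x != v by move=> xV; apply: contraNneq (vV h) => <-.
split.
- by move=> h; have [x xV] := V0 h; exists (exist _ x (neq h x xV)); rewrite inE.
- by move=> h k x; rewrite !inE; apply: Vd.
- move=> h P [x]; rewrite inE => xV Px [y]; rewrite inE => yV Py.
  (* The default [false] is taken only at [v], which lies in no branch set. *)
  pose Q z := if insub z is Some z' then P z' else false.
  have QE (z : del_vertex v) : Q (val z) = P z by rewrite /Q valK.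
  have [||x' [y' [x'V y'V Qx Qy e]]] := Vc h Q.
  + by exists (val x); rewrite ?QE.
  + by exists (val y); rewrite ?QE.
  exists (exist _ x' (neq h x' x'V)), (exist _ y' (neq h y' y'V)).
  by split; rewrite ?inE // -QE.
- move=> h k /Ve[x [y [xV yV e]]].
  exists (exist _ x (neq h x xV)), (exist _ y (neq k y yV)).
  by split; rewrite ?inE.
Qed.

Lemma model_contract (G : sgraph) (V : H -> {set G}) (u v : G) h0 :
  edge u v -> u \in V h0 -> v \in V h0 -> model V ->
  model (fun h => [set x : contract u v | val x \in V h]).
Proof.
move=> euv uV0 vV0 [V0 Vd Vc Ve].
have neuv : u != v by apply: contraTneq euv => ->; rewrite edge_irrefl.
(* The contraction map: the default value of [insubd] sends [v] to [u]. Cuts of the contracted graph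
   are pulled back along [pi]. *)
pose pi : G -> contract u v := insubd (exist _ u neuv : contract u v).
have val_pi x : val (pi x) = if x != v then x else u by rewrite val_insubd.
have piK (x : contract u v) : pi (val x) = x by apply: valKd.
have pi_in h x : x \in V h -> val (pi x) \in V h.
  by rewrite val_pi; case: eqVneq => //= -> vV; rewrite (Vd _ _ _ vV vV0).
have pi_edge x y : edge x y -> pi x != pi y -> edge (pi x) (pi y).
  move=> exy ne; rewrite [edge]/edge /= /contract_rel ne !val_pi /=.
  case: (eqVneq x v) exy => [->|_] /=; case: (eqVneq y v) => [->|_] /= exy.
  + by rewrite edge_irrefl in exy.
  + by rewrite eqxx exy orbT.
  + by rewrite (edge_sym v x) exy eqxx !orbT.
  + by rewrite exy.
split.
- by move=> h; have [x /pi_in xV] := V0 h; exists (pi x); rewrite inE.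
- by move=> h k x; rewrite !inE; apply: Vd.
- move=> h P [x]; rewrite inE => xV Px [y]; rewrite inE => yV Py.
  have [||x' [y' [x'V y'V Qx Qy e]]] := Vc h (P \o pi).
  + by exists (val x); rewrite //= piK.
  + by exists (val y); rewrite //= piK.
  exists (pi x'), (pi y'); split; rewrite ?inE ?pi_in //.
  by apply: pi_edge => //; apply: contraNneq Qy => eqpi; rewrite /= -eqpi.
- move=> h k ehk; have [x [y [xV yV e]]] := Ve h k ehk.
  exists (pi x), (pi y); split; rewrite ?inE ?pi_in //.
  apply: pi_edge => //; apply: contraTneq ehk => pixy.
  by rewrite (Vd h k (val (pi x)) (pi_in _ _ xV)) ?edge_irrefl // pixy pi_in.
Qed.

(** Induction on the order of [G]: delete a vertex outside all branch sets, or contract an edge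
    inside one. Otherwise the branch sets are singletons covering [G], and [minor_spanning]
    applies. *)
Lemma minor_of_model (G : sgraph) (V : H -> {set G}) : model V -> minor H G.
Proof.
have [n] := ubnP #|G|; elim: n G V => // n IHn G V leG mV.
have card_lt (v : G) : #|{: {x : G | x != v}}| < n.
  apply: leq_trans (leG : _ <= n); rewrite card_sig (cardD1 v [pred x : G | true]) /= add1n ltnS.
  by apply: subset_leq_card; apply/subsetP => x; rewrite !inE andbT.
have [/existsP[v /forallP vV]|cov] := boolP [exists v, forall h, v \notin V h].
  by apply: (@minor_del_vertex _ _ v); apply: IHn (model_del_vertex vV mV); apply: card_lt.
have {}cov v : exists h, v \in V h.
  apply/existsP; move: cov; rewrite negb_exists => /forallP/(_ v).
  by rewrite negb_forall => /existsP[h]; rewrite negbK => vV; apply/existsP; exists h.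
have [V0 Vd Vc Ve] := mV.
have [[h [x [y [xV yV nexy]]]]|single] :=
  EM (exists h x y, [/\ x \in V h, y \in V h & x != y]).
  (* The cut isolating [x] in [V h] yields an edge inside [V h]. *)
  have [||u [v [uV vV _ _ euv]]] := Vc h (pred1 x).
  - by exists x; rewrite //= eqxx.
  - by exists y; rewrite //= eq_sym.
  by apply: (minor_contract euv); apply: IHn (model_contract euv uV vV mV); apply: card_lt.
have {}single h x y : x \in V h -> y \in V h -> x = y.
  by move=> xV yV; apply/eqP/negPn/negP=> ne; case: single; exists h, x, y.
have [f fV] := choice V0; have [g gV] := choice cov.
apply: (@minor_spanning _ f).
  exists g => [h|x]; first by apply: (Vd _ _ (f h)).
  by apply: (single (g x)).
move=> h k /Ve[x [y [xV yV]]].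
by rewrite (single _ _ _ xV (fV h)) (single _ _ _ yV (fV k)).
Qed.
End Models.

(** * Winning positions, and guarding by shadows *)

Section Game.
Variables (G : sgraph) (m : nat).
Implicit Types (c : 'I_m -> G) (r : G) (R S : {set G}).

Lemma legal_refl (x : G) : legal_move x x.
Proof. by rewrite /legal_move eqxx. Qed.

Lemma legal_sym (x y : G) : legal_move x y = legal_move y x.
Proof. by rewrite /legal_move eq_sym edge_sym. Qed.

Definition legal_cops c c' := forall j, legal_move (c j) (c' j).

(* Positions, with the cops to move, from which the cops can force a capture. *)
Inductive winning : ('I_m -> G) -> G -> Prop :=
| winning_now c r c' j : legal_cops c c' -> c' j = r -> winning c r
| winning_later c r c' : legal_cops c c' ->
    (forall r', legal_move r r' -> winning c' r') -> winning c r.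

(** The strategy is built along the derivation of [winning], hence the restriction to robbers that
    start at [r]. *)
Lemma winning_strategy c r : winning c r ->
  exists2 sigma : cop_strategy G m, sigma [::] = c &
  forall rho, robber_play rho -> rho 0 = r ->
    (forall i j, legal_move (cops_at sigma rho i j) (cops_at sigma rho i.+1 j)) /\
    captured sigma rho.
Proof.
elim=> {c r} [c r c' j leg c'j|c r c' leg _ IH].
  exists (fun h => if h is [::] then c else c') => // rho _ rho0.
  split=> [[|i] k|]; rewrite /cops_at /mkseq /= ?legal_refl //.
  by exists 0, j; right; rewrite rho0.
have /choice[tau tauP] : forall r', exists tau : cop_strategy G m,
  legal_move r r' -> tau [::] = c' /\
  forall rho, robber_play rho -> rho 0 = r' ->
    (forall i j, legal_move (cops_at tau rho i j) (cops_at tau rho i.+1 j)) /\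
    captured tau rho.
  move=> r'; have [/IH[tau ? ?]|nleg] := boolP (legal_move r r'); first by exists tau.
  by exists (fun=> c).
(* After the robber's first move, to [y], the starting position is dropped from the history and the
   strategy [tau y] takes over. *)
exists (fun h => if h is x :: h' then if h' is y :: _ then tau y h' else c' else c) => //.
set sigma : cop_strategy G m := (X in captured X).
move=> rho play rho0; pose rho' i := rho i.+1.
have leg1 : legal_move r (rho' 0) by rewrite -rho0; apply: play.
have [tau0 /(_ rho' (fun i => play i.+1) erefl)[legt [i [j cap]]]] := tauP _ leg1.
have sigmaS k : cops_at sigma rho k.+1 = cops_at (tau (rho' 0)) rho' k.
  case: k => [|k]; first by rewrite /cops_at /= tau0.
  by rewrite /cops_at /mkseq /= -[2]/(1 + 1) iotaDl -!map_comp.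
split=> [[|k] l|]; first by rewrite sigmaS /cops_at /= tau0; apply: leg.
  by rewrite !sigmaS; apply: legt.
by exists i.+1, j; rewrite !sigmaS.
Qed.

(** The first entry of the history selects the strategy; all of them agree on the initial placement
    [c0]. *)
Lemma winning_cops_win c0 : (forall r, winning c0 r) -> cops_win G m.
Proof.
move=> /(_ _)/winning_strategy W.
have /choice[tau tauP] : forall r, exists tau : cop_strategy G m, tau [::] = c0 /\
  forall rho, robber_play rho -> rho 0 = r ->
    (forall i j, legal_move (cops_at tau rho i j) (cops_at tau rho i.+1 j)) /\
    captured tau rho.
  by move=> r; have [tau ? ?] := W r; exists tau.
pose sigma : cop_strategy G m := fun h => if h is x :: _ then tau x h else c0.
have sigmaE rho i : cops_at sigma rho i = cops_at (tau (rho 0)) rho i.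
  by case: i => [|i] //; rewrite /cops_at /=; have [->] := tauP (rho 0).
exists sigma => rho play; have [_ /(_ _ play erefl)[leg cap]] := tauP (rho 0).
  by move=> i j; rewrite !sigmaE.
by have [i [j]] := cap; rewrite -!sigmaE; exists i, j.
Qed.

(* While the robber is in [R], a cop that follows its shadow [p (g r)] on the
   walk [p] catches it as soon as it enters [S]. *)
Definition shadowing (p : nat -> G) (g : G -> nat) R S := [/\
  forall i, legal_move (p i) (p i.+1),
  forall x y, x \in R -> y \in R :|: S -> legal_move x y ->
    g x <= (g y).+1 /\ g y <= (g x).+1 &
  forall x, x \in S -> p (g x) = x].

(** With the cops to move, a cop at [v] can step onto the shadow of the robber. *)
Definition ready (v r : G) R S :=
  exists p g, shadowing p g R S /\ legal_move v (p (g r)).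

Lemma ready0 v r R : ready v r R set0.
Proof.
exists (fun=> v), (fun=> 0); split; last exact: legal_refl.
by split=> [i|//|x]; rewrite ?legal_refl ?inE.
Qed.

Lemma ready_sub v r R R' S : R' \subset R -> ready v r R S -> ready v r R' S.
Proof.
move=> /subsetP sR [p [g [[pw gl pg] leg]]]; exists p, g; split=> //; split=> // x y xR.
by move=> yRS; apply: gl; [apply: sR|move: yRS; rewrite !inE => /orP[/sR->|->]//; rewrite orbT].
Qed.

Lemma legal_upd c j x : legal_move (c j) x ->
  legal_cops c (fun k => if k == j then x else c k).
Proof. by move=> leg k; case: eqP => [->|_] //; apply: legal_refl. Qed.

Lemma ready_capture c r R S j : ready (c j) r R S -> r \in S -> winning c r.
Proof.
move=> [p [g [[_ _ pg] leg]]] rS; rewrite pg // in leg.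
by apply: (winning_now (legal_upd leg) (j := j)); rewrite eqxx.
Qed.

(** In one round every guard steps onto its shadow while [z] moves freely. The robber's reply shifts
    each shadow by at most one step of its walk, so guards stay ready; a robber leaving [R] enters a
    guarded set and is caught. *)
Lemma guarded_round c r R (Sf : 'I_m -> {set G}) z x :
  r \in R -> (forall y, y \in nbrs R -> exists2 j, j != z & y \in Sf j) ->
  (forall j, j != z -> ready (c j) r R (Sf j)) -> legal_move (c z) x ->
  (forall c' r', r' \in R -> legal_move r r' -> c' z = x ->
     (forall j, j != z -> ready (c' j) r' R (Sf j)) -> winning c' r') ->
  winning c r.
Proof.
move=> rR cover rdy leg next.
have /choice[d dP] : forall j, exists d : G, legal_move (c j) d /\
    if j == z then d = x else exists p g, shadowing p g R (Sf j) /\ d = p (g r).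
  move=> j; case: eqVneq => [->|/rdy[p [g [sh legj]]]]; first by exists x.
  by exists (p (g r)); split=> //; exists p, g.
have ready' j r' : j != z -> legal_move r r' -> r' \in R :|: Sf j ->
    ready (d j) r' R (Sf j).
  move=> jz legr r'RS; have [_] := dP j; rewrite (negPf jz) => -[p [g [sh ->]]].
  have [pw gl pg] := sh; exists p, g; split=> //.
  have [le1 le2] := gl _ _ rR r'RS legr.
  have [lt|gt|->] := ltngtP (g r) (g r'); last exact: legal_refl.
    by rewrite (_ : g r' = (g r).+1) ?pw //; apply/eqP; rewrite eqn_leq le2.
  by rewrite legal_sym (_ : g r = (g r').+1) ?pw //; apply/eqP; rewrite eqn_leq le1.
apply: (@winning_later _ _ d) => [j|r' legr]; first by have [] := dP j.
have [r'R|r'R] := boolP (r' \in R).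
  apply: next => //; first by have := dP z; rewrite eqxx => -[].
  by move=> j jz; apply: ready' => //; rewrite inE r'R.
have [|j jz r'S] := cover r'.
  apply/nbrsP; split=> //; exists r => //; move: legr r'R.
  by rewrite /legal_move; case: eqP => [<-|//]; rewrite rR.
by apply: (@ready_capture _ _ R (Sf j) j) => //; apply: ready' => //; rewrite inE r'S orbT.
Qed.

(* A free cop [z] first walks to [p 0], then climbs the walk [p] until it meets
   the shadow, which it cannot overrun; the other cops meanwhile keep the robber
   inside [R]. *)
Lemma acquire_guard c r R (Sf : 'I_m -> {set G}) z p g S :
  connected_graph G -> r \in R ->
  (forall y, y \in nbrs R -> exists2 j, j != z & y \in Sf j) ->
  (forall j, j != z -> ready (c j) r R (Sf j)) -> shadowing p g R S ->
  (forall c' r', r' \in R ->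
     (forall j, j != z -> ready (c' j) r' R (Sf j)) ->
     ready (c' z) r' R S -> winning c' r') ->
  winning c r.
Proof.
move=> cG + cover + sh win; have [pw gl _] := sh.
(* The cop at [p i] is at most one step ahead of the shadow; [n] bounds the number of steps left to
   climb. *)
have climb n : forall i c r, \max_x g x <= i + n -> i <= (g r).+1 -> c z = p i ->
    r \in R -> (forall j, j != z -> ready (c j) r R (Sf j)) -> winning c r.
  elim: n => [|n IHn] i {}c {}r len ler cz rR rdy.
    have gr : g r <= i by rewrite -(addn0 i); apply: leq_trans len; apply: leq_bigmax.
    apply: win => //; exists p, g; split=> //; rewrite cz.
    have [<-|ne] := eqVneq (g r) i; first exact: legal_refl.
    by rewrite (_ : i = (g r).+1) 1?legal_sym ?pw //; lia.
  have [lt|ge] := ltnP i.+1 (g r).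
    apply: (@guarded_round c r R Sf z (p i.+1)) => //; first by rewrite cz.
    move=> c' r' r'R legr c'z rdy'; apply: (IHn i.+1) => //; first lia.
    have r'RS : r' \in R :|: S by rewrite inE r'R.
    by have [] := gl r r' rR r'RS legr; lia.
  apply: win => //; exists p, g; split=> //; rewrite cz.
  have [<-|[->|<-]] : g r = i \/ g r = i.+1 \/ (g r).+1 = i by lia.
  - exact: legal_refl.
  - exact: pw.
  - by rewrite legal_sym.
have /connectP[s] := cG (c z) (p 0).
elim: s c r => [|x s IHs] c r /= => [_ p0 rR rdy|/andP[ex xs] lasts rR rdy].
  by apply: (climb (\max_x g x) 0).
apply: (@guarded_round c r R Sf z x) => //; first by rewrite /legal_move ex orbT.
by move=> c' r' r'R _ c'z rdy'; apply: IHs; rewrite ?c'z.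
Qed.
End Game.

(** * Shortest paths through a region, guarded by one cop *)

Section Geodesics.
Variable G : sgraph.
Implicit Types (R : {set G}).

(** The shadow of a vertex is the point of the geodesic at the same distance from [a], with
    distances capped at that of [b]. Such a map moves by at most one along an edge and fixes the
    geodesic. *)
Lemma geodesic_shadowing R a b : conn R -> a \in nbrs R -> b \in nbrs R -> a != b ->
  exists (Q : seq G) p g, [/\ shadowing p g R [set x in Q],
    [/\ Q != [::], sorted edge Q & uniq Q],
    forall d, head d Q = a /\ last d Q = b,
    forall x, x \in Q -> [\/ x = a, x = b | x \in R] & exists2 x, x \in Q & x \in R].
Proof.
move=> cR /nbrsP[aR [a' a'R ea]] /nbrsP[bR [b' b'R eb]] neab.
(* Only steps through [R] count: an edge [ab] must not shorten the walk. *)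
pose e := [rel x y | edge x y &&
  ((x \in R) && (y \in b |: R) || (x == a) && (y \in R))].
pose reach n x := `[< exists s, [/\ path e a s, last a s = x & size s <= n] >].
have reachS n x y : reach n x -> e x y -> reach n.+1 y.
  move=> /asboolP[s [ps ls ss]] exy; apply/asboolP; exists (rcons s y).
  by rewrite rcons_path ps ls last_rcons size_rcons.
have ex_reach x : x \in R -> exists n, reach n x.
  move=> xR; have [//|nx] := EM (exists n, reach n x).
  have [||y [z [yR zR /asboolP[n ny] /asboolP nz eyz]]] :=
    cR (fun x => `[< exists n, reach n x >]).
  - exists a' => //; apply/asboolP; exists 1; apply/asboolP; exists [:: a'].
    by rewrite /= eqxx a'R edge_sym ea orbT.
  - by exists x => //; apply/asboolP.
  by case: nz; exists n.+1; apply: reachS ny _; rewrite /= eyz yR inE zR orbT.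
have ex_b : exists n, reach n b.
  have [n nb'] := ex_reach b' b'R; exists n.+1; apply: reachS nb' _.
  by rewrite /= eb b'R setU11.
case: (ex_minnP ex_b) => n /asboolP[s [ps ls ss]] min_n.
(* The distance from [a] along [e], capped at [n]: [find] returns the length [n] of the list when it
   fails. *)
pose g x := find (fun k => reach k x) (iota 0 n).
have g_le x : g x <= n by rewrite /g -[X in _ <= X](size_iota 0 n) find_size.
have g_reach k x : reach k x -> g x <= k.
  move=> kx; have [kn|nk] := ltnP k n; last exact: leq_trans (g_le x) nk.
  by rewrite leqNgt; apply/negP=> /(before_find 0); rewrite nth_iota // add0n kx.
have reach_g x : g x < n -> reach (g x) x.
  move=> lt; have := lt; rewrite -{1}[n](size_iota 0 n) -has_find.
  by move/(nth_find 0); rewrite nth_iota.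
have gS x y : e x y -> g y <= (g x).+1.
  move=> exy; have [lt|nlt] := ltnP (g x) n; first by apply/g_reach/(reachS _ _ _ (reach_g _ lt)).
  by rewrite (leq_trans (g_le y)) // leqW.
have ga : g a = 0 by apply/eqP; rewrite -leqn0; apply: g_reach; apply/asboolP; exists [::].
have gb : g b = n.
  apply/eqP; rewrite eqn_leq g_le leqNgt; apply/negP=> lt.
  by have := min_n _ (reach_g _ lt); lia.
have step i : i < size s -> e (nth b (a :: s) i) (nth b (a :: s) i.+1).
  by move=> lti; apply: (pathP b ps).
have g_up i : i <= size s -> g (nth b (a :: s) i) <= i.
  elim: i => [|i IHi] lei; first by rewrite /= ga.
  by apply: leq_trans (gS _ _ (step _ lei)) _; rewrite ltnS IHi // ltnW.
have nth_size : nth b (a :: s) (size s) = b by rewrite -last_nth.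
(* Counting back from [b], where [g] is [n], bounds [g] from below; with [g_up] this forces [g] to
   be the index along the path. *)
have g_down i : i <= size s -> n <= g (nth b (a :: s) (size s - i)) + i.
  elim: i => [|i IHi] lei; first by rewrite subn0 nth_size gb; lia.
  have := gS _ _ (step (size s - i.+1) _); rewrite subnSK //.
  by have := IHi (ltnW lei); lia.
have sn : size s = n by have := g_down _ (leqnn (size s)); rewrite subnn /= ga; lia.
have g_nth i : i <= n -> g (nth b (a :: s) i) = i.
  move=> lei; have := g_up i; have := g_down (n - i); rewrite sn subKn //; lia.
have memQ x : x \in a :: s -> exists2 i, i <= n & x = nth b (a :: s) i.
  by move=> xQ; exists (index x (a :: s)); rewrite ?nth_index //
    -ltnS -sn -/(size (a :: s)) index_mem.
have QR x : x \in a :: s -> [\/ x = a, x = b | x \in R].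
  move/memQ=> [[|i] lei ->]; first by constructor 1.
  have /= /andP[_ /orP[]/andP[_]] := step i (leq_trans lei (eq_leq (esym sn))).
    by case/setU1P; [constructor 2|constructor 3].
  by constructor 3.
exists (a :: s), (nth b (a :: s)), g; split.
- split=> [i|x y xR yRQ|x].
  + have [lti|gei] := ltnP i (size s).
      by have /= /andP[exy _] := step i lti; rewrite /legal_move exy orbT.
    (* Past its end the walk rests at [b], the default value of [nth]. *)
    rewrite [X in legal_move _ X]nth_default //.
    have [->|ne] := eqVneq i (size s); first by rewrite nth_size /legal_move eqxx.
    by rewrite nth_default /legal_move ?eqxx //=; lia.
  + case/orP=> [/eqP->|exy]; first by split; apply: leqnSn.
    have : y \in R \/ y \in a :: s by move: yRQ; rewrite !inE => /orP[|]; [left|right].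
    have yRP : y \in R -> g x <= (g y).+1 /\ g y <= (g x).+1.
      by move=> yR; split; apply: gS; rewrite /= !inE ?exy ?(edge_sym y) ?exy xR yR !orbT.
    (* At [a] and at [b] an [e]-step gives only one of the two bounds; the other follows from
       [g a = 0] or from [g_le]. *)
    case=> [/yRP//|/QR[ya|yb|/yRP//]].
      rewrite ya; split; last by rewrite ga.
      by apply: gS; rewrite /= xR eqxx edge_sym -ya exy orbT.
    by rewrite yb gb; split; [rewrite leqW|rewrite -gb; apply: gS; rewrite /= xR -yb exy !inE eqxx].
  + by rewrite inE => /memQ[i lei ->]; rewrite g_nth.
- split=> //; first by apply: sub_path ps => x y /andP[].
  apply/(uniqP b) => i j; rewrite !inE /= !ltnS sn => lei lej eqij.
  by rewrite -(g_nth i) // eqij g_nth.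
- by move=> d; rewrite /= ls.
- exact: QR.
- case: s ps ls {ss step g_up nth_size g_down sn g_nth memQ QR}
    => [_ ab|y s /= /andP[/andP[_ yR] _] _].
    by move: neab; rewrite -ab /= eqxx.
  by exists y; rewrite ?inE ?eqxx ?orbT //; case/orP: yR => /andP[] //; rewrite (negPf aR).
Qed.
End Geodesics.

(** * Systems of strands between two connected sets *)

Section Strands.
Variables (G : sgraph) (m : nat) (x0 : G).
Implicit Types (I : {set 'I_m}) (T : 'I_m -> seq G) (A B D R : {set G}).
Implicit Types (a b x y : G).

(** While [A] is empty, the vertex [a] stands in for it: all strands start there. *)
Definition attached A a x := (exists2 u, u \in A & edge u x) \/ (A = set0 /\ x = a).

(* [a] and [b] only matter if two strands share an end, or if [A] or [B] is empty. *)
Record skeleton I T A B a b : Prop := Skeleton {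
  skel_connA : conn A;
  skel_connB : conn B;
  skel_disjoint : forall x, x \in A -> x \notin B;
  skel_path : forall i, i \in I -> [/\ T i != [::], sorted edge (T i) & uniq (T i)];
  skel_avoid : forall i x, i \in I -> x \in T i -> x \notin A /\ x \notin B;
  skel_head : forall i, i \in I -> attached A a (head x0 (T i));
  skel_last : forall i, i \in I -> attached B b (last x0 (T i));
  skel_share : forall i j x, i \in I -> j \in I -> i != j -> x \in T i -> x \in T j ->
    [/\ x = a, head x0 (T i) = a & head x0 (T j) = a] \/
    [/\ x = b, last x0 (T i) = b & last x0 (T j) = b] }.

(** For [D = nbrs R], a strand failing this is redundant as a cover of the boundary. *)
Definition private D I T := forall i, i \in I ->
  exists x, [/\ x \in D, x \in T i & forall j, j \in I -> j != i -> x \notin T j].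

Definition headfree I T a := forall i j, i \in I -> j \in I -> i != j ->
  head x0 (T i) = a -> head x0 (T j) = a -> False.

Lemma head_mem (s : seq G) : s != [::] -> head x0 s \in s.
Proof. by case: s => //= x s _; rewrite mem_head. Qed.

Lemma last_mem (s : seq G) : s != [::] -> last x0 s \in s.
Proof. by case: s => //= x s _; rewrite mem_last. Qed.

Lemma head_last_uniq (s : seq G) y : uniq s -> head x0 s = last x0 s ->
  y \in s -> y = head x0 s.
Proof.
case: s => // x s /= /andP[xs _]; case: s xs => [|z s] xs xl.
  by rewrite inE => /eqP.
by rewrite xl /= mem_last in xs.
Qed.

Lemma head_rev (s : seq G) : head x0 (rev s) = last x0 s.
Proof. by case/lastP: s => // s x; rewrite rev_rcons last_rcons. Qed.

Lemma last_rev (s : seq G) : last x0 (rev s) = head x0 s.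
Proof. by rewrite -head_rev revK. Qed.

(** This symmetry reduces every claim about last vertices to one about heads. *)
Lemma skeleton_rev I T A B a b :
  skeleton I T A B a b -> skeleton I (fun i => rev (T i)) B A b a.
Proof.
case=> cA cB dAB pT aT hT lT sT; split=> // [x xB|i iI|i x iI|i iI|i iI|i j x iI jI ij].
- by apply/negP=> /dAB; rewrite xB.
- have [T0 Tp Tu] := pT i iI; split; rewrite ?rev_uniq //.
    by rewrite -size_eq0 size_rev size_eq0.
  by rewrite rev_sorted; apply: sub_sorted Tp => x y; rewrite edge_sym.
- by rewrite mem_rev => /(aT i x iI)[].
- by rewrite head_rev; apply: lT.
- by rewrite last_rev; apply: hT.
- rewrite !mem_rev !head_rev !last_rev => xi xj.
  by have [] := sT i j x iI jI ij xi xj; [right|left].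
Qed.

Lemma private_rev D I T : private D I T -> private D I (fun i => rev (T i)).
Proof.
move=> pT i iI; have [x [xD xi xj]] := pT i iI; exists x; rewrite mem_rev.
by split=> // j jI ji; rewrite mem_rev xj.
Qed.

(** If the head of [T i] met [T j] at [b] instead, it would also be the last vertex of [T i], and
    this one-vertex strand would have no private vertex. *)
Lemma private_head D I T A B a b i j : skeleton I T A B a b -> private D I T ->
  i \in I -> j \in I -> head x0 (T i) \in T j -> head x0 (T j) = head x0 (T i).
Proof.
move=> sk pT iI jI hj; have [->//|ij] := eqVneq i j.
have [T0 _ Tu] := skel_path sk iI.
have [[-> _ ->]//|[hb lb _]] := skel_share sk iI jI ij (head_mem T0) hj.
have [y [_ yi yj]] := pT i iI; have /negP[] : y \notin T j by rewrite yj // eq_sym.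
by rewrite (head_last_uniq Tu _ yi) // hb lb.
Qed.

Lemma private_head_last D I T A B a b i j : skeleton I T A B a b -> private D I T ->
  i \in I -> j \in I -> i != j -> head x0 (T i) \in T j -> head x0 (T i) != last x0 (T i).
Proof.
move=> sk pT iI jI ij hj; apply/eqP=> hl; have [_ _ Tu] := skel_path sk iI.
have [y [_ yi yj]] := pT i iI; have /negP[] : y \notin T j by rewrite yj // eq_sym.
by rewrite (head_last_uniq Tu _ yi).
Qed.

Definition chop T x i := if head x0 (T i) == x then behead (T i) else T i.

Lemma mem_chop T x i y : y \in chop T x i -> y \in T i.
Proof. by rewrite /chop; case: ifP => // _; apply: mem_behead. Qed.

Lemma chop_mem T x i y : y != x -> y \in T i -> y \in chop T x i.
Proof.
rewrite /chop; case: ifP => [/eqP<-|//]; case: (T i) => //= z s /negPf yz.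
by rewrite inE yz.
Qed.

Lemma last_chop T x i : chop T x i != [::] -> last x0 (chop T x i) = last x0 (T i).
Proof. by rewrite /chop; case: ifP => // _; case: (T i) => [|y [|z s]]. Qed.

Lemma private_chop D I T x :
  (forall i, i \in I -> exists y, [/\ y \in D, y \in T i, y != x &
     forall j, j \in I -> j != i -> y \notin T j]) -> private D I (chop T x).
Proof.
move=> pT i /pT[y [yD yi yx yj]]; exists y; split=> //; first exact: chop_mem.
by move=> j jI ji; apply: contra (yj j jI ji); apply: mem_chop.
Qed.

(** Every strand through [x] starts there, so chopping frees [x] for [A]; a shortened strand now
    starts at a neighbour of [x]. *)
Lemma skeleton_chop I T A B a b x :
  skeleton I T A B a b -> (exists2 i, i \in I & head x0 (T i) = x) ->
  (forall i, i \in I -> x \in T i -> head x0 (T i) = x) ->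
  (forall i, i \in I -> exists2 y, y \in T i & y != x) ->
  skeleton I (chop T x) (x |: A) B a b.
Proof.
move=> sk [i0 i0I hi0] hx nx; have [cA cB dAB pT aT hT lT sT] := sk.
have [T0 _ _] := pT i0 i0I; have xi0 := head_mem T0; rewrite hi0 in xi0.
have [xA xB] := aT i0 x i0I xi0.
have cT0 i : i \in I -> chop T x i != [::].
  by case/nx=> y yi yx; have := chop_mem yx yi; case: chop.
have xT i : i \in I -> x \notin chop T x i.
  move=> iI; rewrite /chop; case: eqP => [|/eqP hne]; last by apply: contra hne => /(hx i iI)->.
  by have [_ _] := pT i iI; case: (T i) => //= y s /andP[ys _] <-.
split=> //.
- apply: connU1 => //; have := hT i0 i0I; rewrite hi0.
  by case=> [|[-> _]]; [right|left].
- by move=> y /setU1P[->//|/dAB].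
- move=> i iI; have [_ Tp Tu] := pT i iI; split; first exact: cT0.
    by rewrite /chop; case: ifP => // _; case: (T i) Tp => //= y s /path_sorted.
  by rewrite /chop; case: ifP => // _; case: (T i) Tu => //= y s /andP[].
- move=> i y iI yi; have [yA yB] := aT i y iI (mem_chop yi).
  by rewrite !inE negb_or yA yB; split=> //; rewrite andbT; apply: contraTneq yi => ->; apply: xT.
- move=> i iI; have := cT0 i iI; have [T0i Tp _] := pT i iI; rewrite /chop.
  case: (eqVneq (head x0 (T i)) x) => [hix|hne] cne.
    case: (T i) hix Tp cne => [|y [|z s]] //= -> /andP[exz _] _.
    by left; exists x; rewrite ?setU11.
  (* If [A] was empty, both [x] and the head of [T i] are [a], against [hne]. *)
  left; have [[u uA eu]|[A0 ha]] := hT i iI; first by exists u; rewrite ?setU1r.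
  have := hT i0 i0I; rewrite A0 hi0 => -[[u]|[_ xa]]; first by rewrite inE.
  by rewrite ha xa eqxx in hne.
- by move=> i iI; rewrite last_chop ?cT0 //; apply: lT.
- move=> i j y iI jI ij yi yj; rewrite !last_chop ?cT0 //.
  have [[ya hi hj]|] := sT i j y iI jI ij (mem_chop yi) (mem_chop yj); last by right.
  have yx : y != x by apply: contraTneq yi => ->; apply: xT.
  by left; rewrite ya in yx *; rewrite /chop hi hj (negPf yx).
Qed.

(* Once no two strands share their head, [A] can serve as a branch set. *)
Lemma skeleton_headfree D I T A B a b : skeleton I T A B a b -> private D I T ->
  exists T' A', [/\ skeleton I T' A' B a b, private D I T', headfree I T' a,
    forall i, i \in I -> last x0 (T' i) = last x0 (T i) /\ {subset T' i <= T i} &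
    forall x, x \in A' -> x \in A \/ exists2 i, i \in I & x \in T i].
Proof.
move=> sk pT; have [free|nfree] := EM (headfree I T a).
  by exists T, A; split=> [|||i _|x xA] //; [split|left].
have [i [j [iI jI ij hi hj]]] : exists i j, [/\ i \in I, j \in I, i != j,
    head x0 (T i) = a & head x0 (T j) = a].
  by apply: contrapT => nex; apply: nfree => i j iI jI ij hi hj; apply: nex; exists i, j.
have [Ti0 _ _] := skel_path sk iI; have [Tj0 _ _] := skel_path sk jI.
have ai : a \in T i by rewrite -hi head_mem.
have aj : a \in T j by rewrite -hj head_mem.
have pT' k : k \in I -> exists y, [/\ y \in D, y \in T k, y != a &
     forall l, l \in I -> l != k -> y \notin T l].
  move=> kI; have [y [yD yk yl]] := pT k kI; exists y; split=> //; apply/eqP=> ya.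
  have [ik|ik] := eqVneq i k; last by have := yl i iI ik; rewrite ya ai.
  by have := yl j jI; rewrite -ik eq_sym ij ya aj => /(_ isT).
have ahead k : k \in I -> a \in T k -> head x0 (T k) = a.
  by move=> kI ak; rewrite (private_head sk pT iI kI) ?hi.
have sk' : skeleton I (chop T a) (a |: A) B a b.
  apply: skeleton_chop => //; first by exists i.
  by move=> k /pT'[y [_ yk ya _]]; exists y.
exists (chop T a), (a |: A); split=> //.
- exact: private_chop.
- move=> k l kI lI kl hk _; have [ck0 _ _] := skel_path sk' kI.
  by have [] := skel_avoid sk' kI (head_mem ck0); rewrite hk setU11.
- move=> k kI; have [ck0 _ _] := skel_path sk' kI.
  by split; [apply: last_chop|move=> y; apply: mem_chop].
- by move=> y /setU1P[->|]; [right; exists i|left].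
Qed.

(** No sharing happens at [a]; and if [A] is empty, all heads are [a], so there is just one strand
    and [a'] is its head. *)
Lemma skeleton_rebase I T A B a b a' : skeleton I T A B a b -> headfree I T a ->
  (exists2 i, i \in I & head x0 (T i) = a') -> skeleton I T A B a' b.
Proof.
move=> sk free [i0 i0I hi0]; have [cA cB dAB pT aT hT lT sT] := sk.
split=> // [i iI|i j x iI jI ij xi xj].
  have [|[A0 hi]] := hT i iI; [by left|right; split=> //].
  have [[u]|[_ hi0a]] := hT i0 i0I; first by rewrite A0 inE.
  by have [<-|ne] := eqVneq i0 i; last by case: (free i0 i).
have [[xa hi hj]|] := sT i j x iI jI ij xi xj; last by right.
by case: (free i j).
Qed.

(** This chooses the ends of the next strand. A vertex where two strands share an end must be kept;
    on a side without sharing, any strand end will do, by [skeleton_rebase]. A lone one-vertex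
    strand is excluded, as it offers no two distinct ends. *)
Lemma skeleton_ends D I T A B a b : skeleton I T A B a b -> private D I T ->
  I != set0 -> (forall i, i \in I -> head x0 (T i) = last x0 (T i) -> I != [set i]) ->
  exists a' b', [/\ a' != b', skeleton I T A B a' b',
    exists2 i, i \in I & head x0 (T i) = a' & exists2 i, i \in I & last x0 (T i) = b'].
Proof.
move=> sk pT I0 Isingle.
have shared T' c : ~ headfree I T' c -> exists i j, [/\ i \in I, j \in I, i != j,
    head x0 (T' i) = c & head x0 (T' j) = c].
  move=> nfree; apply: contrapT => nex; apply: nfree => i j iI jI ij hi hj.
  by apply: nex; exists i, j.
have headN I' T' A' B' c d i j : skeleton I' T' A' B' c d -> private D I' T' ->
    i \in I' -> j \in I' -> i != j -> head x0 (T' i) = c -> head x0 (T' j) = c ->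
    last x0 (T' i) != c.
  move=> sk' pT' iI jI ij hi hj; have [Tj0 _ _] := skel_path sk' jI.
  rewrite eq_sym -{1}hi; apply: (private_head_last sk' pT' iI jI) => //.
  by rewrite hi -hj head_mem.
pose T' i := rev (T i).
have sk' : skeleton I T' B A b a := skeleton_rev sk.
have pT' : private D I T' := private_rev pT.
have [fa|/shared[i [j [iI jI ij hi hj]]]] := EM (headfree I T a); last first.
  have [fb|/shared[k [l [kI lI kl]]]] := EM (headfree I T' b); last first.
    rewrite /T' !head_rev => lk ll; exists a, b; split=> //; [|by exists i|by exists k].
    apply/eqP=> ab; wlog ik : k l kI lI kl lk ll / i != k.
      move=> W; have [ik|] := eqVneq i k; last exact: (W k l).
      by apply: (W l k); rewrite // ?ik // eq_sym.
    have [Tk0 _ _] := skel_path sk kI.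
    have hk : head x0 (T i) \in T k by rewrite hi ab -lk last_mem.
    have hk' := private_head sk pT iI kI hk.
    by have := headN _ _ _ _ _ _ k i sk pT kI iI;
    rewrite eq_sym hk' hi lk ab eqxx => /(_ ik erefl erefl).
  exists a, (last x0 (T i)); split; [|  |by exists i|by exists i].
    by rewrite eq_sym (headN _ _ _ _ _ _ i j sk pT).
  have := skeleton_rev (skeleton_rebase sk' fb (a' := last x0 (T i)) _).
  have -> : (fun i => rev (T' i)) = T by apply: funext => k; rewrite /T' revK.
  by apply; exists i; rewrite // /T' head_rev.
have [fb|/shared[k [l [kI lI kl hk hl]]]] := EM (headfree I T' b); last first.
  exists (head x0 (T k)), b; split; [|  |by exists k|by exists k; rewrite // -hk /T' head_rev].
    by have := headN _ _ _ _ _ _ k l sk' pT' kI lI kl hk hl; rewrite /T' last_rev.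
  by apply: skeleton_rebase sk fa _; exists k.
(* Without sharing on either side the strands are disjoint, so a one-vertex strand can be paired
   with the end of another strand. *)
have disj i j x : i \in I -> j \in I -> i != j -> x \in T i -> x \in T j -> False.
  move=> iI jI ij xi xj; have [[_ hi hj]|[_ li lj]] := skel_share sk iI jI ij xi xj.
    exact: fa hi hj.
  by apply: (fb i j); rewrite // /T' head_rev.
have [i [j [iI jI hl]]] : exists i j, [/\ i \in I, j \in I & head x0 (T i) != last x0 (T j)].
  have [i iI] := set0Pn _ I0;
  have [hl|] := eqVneq (head x0 (T i)) (last x0 (T i)); last by exists i, i.
  have [j jI ij] : exists2 j, j \in I & i != j.
    have := Isingle i iI hl; rewrite eqEsubset sub1set iI andbT => /subsetPn[j jI].
    by rewrite inE eq_sym; exists j.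
  exists i, j; split=> //; apply/eqP=> eq; apply: (disj i j (head x0 (T i))) => //.
    by have [T0 _ _] := skel_path sk iI; apply: head_mem.
  by have [T0 _ _] := skel_path sk jI; rewrite eq last_mem.
exists (head x0 (T i)), (last x0 (T j)); split=> //; [|by exists i|by exists j].
have sk1 : skeleton I T A B (head x0 (T i)) b by apply: skeleton_rebase sk fa _; exists i.
have := skeleton_rev (skeleton_rebase (skeleton_rev sk1) fb (a' := last x0 (T j)) _).
have -> : (fun i => rev (rev (T i))) = T by apply: funext => k; rewrite revK.
by apply; exists j; rewrite // head_rev.
Qed.

(** The part of [Q] in [R] avoids all strands. An old strand through [a] must start there: sharing
    [a] as a last vertex would give [a = b]. The same holds at [b]. *)
Lemma skeleton_extend I T A B a b z Q R : skeleton I T A B a b -> a != b -> z \notin I ->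
  (exists2 i, i \in I & head x0 (T i) = a) -> (exists2 i, i \in I & last x0 (T i) = b) ->
  [/\ Q != [::], sorted edge Q & uniq Q] -> head x0 Q = a -> last x0 Q = b ->
  (forall x, x \in Q -> [\/ x = a, x = b | x \in R]) ->
  (forall x, x \in R -> [/\ x \notin A, x \notin B & forall i, i \in I -> x \notin T i]) ->
  skeleton (z |: I) (fun i => if i == z then Q else T i) A B a b.
Proof.
move=> sk ab zI [i iI hi] [j jI lj] pQ hQ lQ QR avR.
have [cA cB dAB pT aT hT lT sT] := sk.
have [Ti0 _ _] := pT i iI; have [Tj0 _ _] := pT j jI.
have ai : a \in T i by rewrite -hi head_mem.
have bj : b \in T j by rewrite -lj last_mem.
have [zi zj] : i != z /\ j != z by split; apply: contraNneq zI => <-.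
have shareQ k x : k \in I -> x \in Q -> x \in T k ->
    x = a /\ head x0 (T k) = a \/ x = b /\ last x0 (T k) = b.
  move=> kI xQ xk; have [xa|xb|/avR[_ _ /(_ k kI)]] := QR x xQ; last by rewrite xk.
    left; split=> //; have [<-//|ik] := eqVneq i k; rewrite xa in xk.
    have [[]//|[ab' _ _]] := sT i k a iI kI ik ai xk.
    by rewrite ab' eqxx in ab.
  right; split=> //; have [<-//|jk] := eqVneq j k; rewrite xb in xk.
  have [[ba _ _]|[]//] := sT j k b jI kI jk bj xk.
  by rewrite ba eqxx in ab.
have inI k : k \in z |: I -> k != z -> k \in I by case/setU1P=> [->|//]; rewrite eqxx.
split=> // [k kI|k x kI|k kI|k kI|k l x kI lI kl]; case: (eqVneq k z) => [kz|/(inI k kI) kI'] //;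
  try exact: pT; try exact: aT; try exact: hT; try exact: lT.
- by case/QR=> [->|->|/avR[]//]; [apply: (aT i)|apply: (aT j)].
- by rewrite hQ; have := hT i iI; rewrite hi.
- by rewrite lQ; have := lT j jI; rewrite lj.
- case: (eqVneq l z) => [lz|/(inI l lI) lI']; first by rewrite kz lz eqxx in kl.
  by move=> xQ xl; have [[]|[]] := shareQ l x lI' xQ xl; [left|right].
- case: (eqVneq l z) => [lz|/(inI l lI) lI'].
    by move=> xk xQ; have [[]|[]] := shareQ k x kI' xQ xk; [left|right].
  exact: sT.
Qed.

(** * Guarded regions: normalization, the minor, and the shrinking step *)

Implicit Types (Sf : 'I_m -> {set G}).

(* [Sf i] is the set guarded by cop [i]. *)
Record state R Sf I T A B a b : Prop := State {
  state_skel : skeleton I T A B a b;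
  state_conn : conn R;
  state_avoid : forall x, x \in R ->
    [/\ x \notin A, x \notin B & forall i, i \in I -> x \notin T i];
  state_nbrs : forall x, x \in nbrs R -> x \notin A /\ x \notin B;
  state_cover : forall x, x \in nbrs R -> exists2 i, i \in I & x \in T i;
  state_guard : forall i x, i \in I -> x \in nbrs R -> x \in T i -> x \in Sf i }.

Definition tame R Sf := exists I T A B a b, state R Sf I T A B a b.

Lemma state_rev R Sf I T A B a b : state R Sf I T A B a b ->
  state R Sf I (fun i => rev (T i)) B A b a.
Proof.
case=> sk cR av nb cov gd; split=> // [|x /av[xA xB xT]|x /nb[]|x /cov[i iI xi]|i x iI xN].
- exact: skeleton_rev.
- by split=> // i iI; rewrite mem_rev xT.
- by [].
- by exists i; rewrite ?mem_rev.
- by rewrite mem_rev; apply: gd.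
Qed.

Definition weight I T := \sum_(i in I) size (T i).

Lemma state_drop R Sf I T A B a b i : state R Sf I T A B a b -> i \in I ->
  (forall x, x \in nbrs R -> x \in T i -> exists2 j, j \in I & (j != i) && (x \in T j)) ->
  state R Sf (I :\ i) T A B a b /\ weight (I :\ i) T < weight I T.
Proof.
move=> [sk cR av nb cov gd] iI red; split; last first.
  rewrite /weight [X in _ < X](big_setD1 i) //= -[X in X < _]add0n ltn_add2r.
  by have [T0 _ _] := skel_path sk iI; rewrite lt0n size_eq0.
have sub j : j \in I :\ i -> j \in I by case/setD1P.
split=> // [|x xR|x xN|j x /sub]; last exact: gd.
- have [cA cB dAB pT aT hT lT sT] := sk.
  by split=> // [j /sub|j x /sub|j /sub|j /sub|j k x /sub jI /sub];
    [apply: pT|apply: aT|apply: hT|apply: lT|apply: sT].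
- by have [xA xB xT] := av x xR; split=> // j /sub; apply: xT.
- have [j jI xj] := cov x xN; have [ji|ji] := eqVneq j i.
    have [|k kI /andP[ki xk]] := red x xN; first by rewrite -ji.
    by exists k; rewrite // in_setD1 ki.
  by exists j; rewrite // in_setD1 ji.
Qed.

(** The head lies outside the boundary, so moving it into [A] uncovers nothing; private vertices lie
    on the boundary, so no strand becomes empty. *)
Lemma state_chop R Sf I T A B a b i : state R Sf I T A B a b ->
  private (nbrs R) I T -> i \in I -> head x0 (T i) \notin nbrs R ->
  exists T' A', state R Sf I T' A' B a b /\ weight I T' < weight I T.
Proof.
move=> [sk cR av nb cov gd] pT iI hN; set x := head x0 (T i).
have [T0 _ _] := skel_path sk iI; have xi : x \in T i by apply: head_mem.
have neN y : y \in nbrs R -> y != x by move=> yN; apply: contraTneq yN => ->.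
exists (chop T x), (x |: A); split.
  split=> // [|y yR|y yN|y yN|j y jI yN /mem_chop]; last exact: gd.
  - apply: skeleton_chop => //; first by exists i.
      by move=> j jI; apply: private_head sk pT iI jI.
    by move=> j /pT[y [/neN yx yj _]]; exists y.
  - have [yA yB yT] := av y yR; split=> // [|j jI]; last first.
      exact: contra (@mem_chop _ _ _ _) (yT j jI).
    by rewrite in_setU1 negb_or yA andbT; apply: contraTneq xi => <-; apply: yT.
  - by have [yA yB] := nb y yN; rewrite in_setU1 negb_or yA neN.
  - by have [j jI yj] := cov y yN; exists j; rewrite ?chop_mem ?neN.
have sz j : size (chop T x j) <= size (T j).
  by rewrite /chop; case: ifP => // _; rewrite size_behead leq_pred.
rewrite /weight (big_setD1 i) //= [X in _ < X](big_setD1 i) //= -addSn.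
apply: leq_add; last by apply: leq_sum.
by rewrite /chop eqxx size_behead prednK // lt0n size_eq0.
Qed.

(** Drop redundant strands and chop ends off the boundary as long as possible; each operation lowers
    [weight]. *)
Lemma tame_normal R Sf : tame R Sf -> exists I T A B a b,
  [/\ state R Sf I T A B a b, private (nbrs R) I T &
    forall i, i \in I -> head x0 (T i) \in nbrs R /\ last x0 (T i) \in nbrs R].
Proof.
move=> [I [T [A [B [a [b]]]]]]; have [n] := ubnP (weight I T).
elim: n I T A B a b => // n IHn I T A B a b /ltnSE leW st.
have [pT|npT] := EM (private (nbrs R) I T); last first.
  have [i [iI red]] : exists i, i \in I /\
      forall x, x \in nbrs R -> x \in T i -> exists2 j, j \in I & (j != i) && (x \in T j).
    apply: contrapT => nex; apply: npT => i iI; apply: contrapT => nx; apply: nex.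
    exists i; split=> // x xN xi; apply: contrapT => nj; apply: nx.
    by exists x; split=> // j jI ji; apply/negP => xj; apply: nj; exists j; rewrite ?ji.
  have [st' lt] := state_drop st iI red.
  by apply: IHn st'; apply: leq_trans lt leW.
have [[i [iI hN]]|heads] := EM (exists i, i \in I /\ head x0 (T i) \notin nbrs R).
  have [T' [A' [st' lt]]] := state_chop st pT iI hN.
  by apply: IHn st'; apply: leq_trans lt leW.
have [[i [iI lN]]|lasts] := EM (exists i, i \in I /\ last x0 (T i) \notin nbrs R).
  have [|T' [B' [/state_rev st' lt]]] := state_chop (state_rev st) (private_rev pT) iI.
    by rewrite head_rev.
  apply: IHn st'; apply: leq_trans leW.
  have wr U : weight I (fun j => rev (U j)) = weight I U.
    by apply: eq_bigr => j _; rewrite size_rev.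
  by rewrite wr -(wr T).
exists I, T, A, B, a, b; split=> // i iI; split; apply/negPn/negP=> N.
  by apply: heads; exists i.
by apply: lasts; exists i.
Qed.

(* A fresh start from a single strand, with empty [A] and [B]. *)
Lemma tame_path R Sf z (Q : seq G) : conn R -> Q != [::] -> sorted edge Q -> uniq Q ->
  (forall x, x \in Q -> x \notin R) -> {subset nbrs R <= Q} -> {subset Q <= Sf z} ->
  tame R Sf.
Proof.
move=> cR Q0 pQ uQ QR NQ QS.
exists [set z], (fun=> Q), set0, set0, (head x0 Q), (last x0 Q).
split=> // [|x xR|x xN|x xN|i x]; rewrite ?inE //.
- split=> // [||x|i x _ _|i _|i _|i j x]; rewrite ?inE //; try exact: conn0.
  + by right.
  + by right.
  + by move=> /eqP-> /eqP->; rewrite eqxx.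
- by split=> // i _; apply: contraTN xR => /QR.
- by exists z; rewrite ?inE // NQ.
- by move=> /eqP-> _ /QS.
Qed.

(** After separating heads and then last vertices, the strands are disjoint, and each reaches [R]
    through its private boundary vertex. *)
Lemma state_model R Sf I T A B a b : 1 < m -> state R Sf I T A B a b ->
  private (nbrs R) I T -> I = setT -> R != set0 -> minor (complete_bipartite 3 m) G.
Proof.
move=> m1 [sk cR av nb cov gd] pT IT R0.
have [T1 [A1 [sk1 pT1 free1 sub1 A1P]]] := skeleton_headfree sk pT.
have [T2 [B2 [sk2 pT2 free2 sub2 B2P]]] :=
  skeleton_headfree (skeleton_rev sk1) (private_rev pT1).
have inI i : i \in I by rewrite IT inE.
(* Two strands exist since [1 < m]; if [A1] or [B2] were empty, they would share an end there. *)
pose i0 := Ordinal (ltnW m1); pose i1 := Ordinal m1.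
have [cB cA dBA p2 a2 h2 l2 s2] := sk2.
have last2 i : last x0 (T2 i) = head x0 (T1 i).
  by have [-> _] := sub2 i (inI i); rewrite last_rev.
have B0 : B2 != set0.
  apply/eqP=> B0; apply: (free2 i0 i1) => //.
    by have [[u]|[]//] := h2 i0 (inI i0); rewrite B0 inE.
  by have [[u]|[]//] := h2 i1 (inI i1); rewrite B0 inE.
have A0 : A1 != set0.
  have lA i : A1 = set0 -> head x0 (T1 i) = a.
    by move=> A0; rewrite -last2; have [[u]|[]//] := l2 i (inI i); rewrite A0 inE.
  by apply/eqP=> A0; apply: (free1 i0 i1); rewrite ?lA.
have sub i x : x \in T2 i -> x \in T i.
  have [_ /(_ x) s21] := sub2 i (inI i); have [_ /(_ x) s10] := sub1 i (inI i).
  by move=> /s21; rewrite mem_rev => /s10.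
have TR i x : x \in T2 i -> x \notin R.
  by move=> /sub xi; apply/negP=> /av[_ _ /(_ i (inI i))]; rewrite xi.
have AR x : x \in A1 -> x \notin R.
  by move=> /A1P xA; apply/negP=> /av[xA' _ xT]; case: xA => [|[i /xT/negP]//]; rewrite (negPf xA').
have BR x : x \in B2 -> x \notin R.
  move=> /B2P xB; apply/negP=> /av[_ xB' xT]; case: xB => [|[i iI]]; first by rewrite (negPf xB').
  by rewrite mem_rev => /(proj2 (sub1 i iI)) xi; have := xT i iI; rewrite xi.
have disj i j x : i != j -> x \in T2 i -> x \in T2 j -> False.
  move=> ij xi xj.
  have [[_ hi hj]|[_ li lj]] := s2 i j x (inI i) (inI j) ij xi xj; first exact: free2 hi hj.
  by apply: (free1 i j) => //; rewrite -last2.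
pose V (h : complete_bipartite 3 m) : {set G} := match h with
  | inl k => match val k with 0 => A1 | 1 => B2 | _ => R end
  | inr i => [set x in T2 i] end.
have VT i k x : x \in V (inl k) -> x \in V (inr i) -> False.
  rewrite /V inE; case: k => [[|[|k]] ltk] /= xV xi; have := a2 i x (inI i) xi.
  - by rewrite xV => -[].
  - by rewrite xV => -[].
  - by have := TR i x xi; rewrite xV.
have Ve i k : exists x y, [/\ x \in V (inl k), y \in V (inr i) & edge x y].
  have [T0 _ _] := p2 i (inI i); case: k => [[|[|k]] ltk] /=.
  - have [[u uA eu]|[A0']] := l2 i (inI i); last by rewrite A0' eqxx in A0.
    by exists u, (last x0 (T2 i)); rewrite inE last_mem.
  - have [[u uB eu]|[B0']] := h2 i (inI i); last by rewrite B0' eqxx in B0.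
    by exists u, (head x0 (T2 i)); rewrite inE head_mem.
  - have [y [/nbrsP[_ [x xR exy]] yi _]] := pT2 i (inI i).
    by exists x, y; rewrite inE.
apply: (@minor_of_model _ _ V); split.
- case=> [[[|[|k]] ltk]|i] /=; try exact/set0Pn.
  by have [T0 _ _] := p2 i (inI i); exists (head x0 (T2 i)); rewrite inE head_mem.
- move=> h k x; case: h k => [h|i] [k|j] xh xk.
  + congr inl; apply: val_inj; move: xh xk;
    case: h k => [[|[|[|h]]] lth] [[|[|[|k]]] ltk] //= xh xk.
    * by have := dBA x xk; rewrite xh.
    * by have := AR x xh; rewrite xk.
    * by have := dBA x xh; rewrite xk.
    * by have := BR x xh; rewrite xk.
    * by have := AR x xk; rewrite xh.
    * by have := BR x xk; rewrite xh.
  + by case: (VT j h x).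
  + by case: (VT i k x).
  + by congr inr; apply/eqP/negPn/negP=> ij; move: xh xk; rewrite /V !inE; apply: disj.
- case=> [[[|[|k]] ltk]|i] //=.
  by apply: conn_path; have [] := p2 i (inI i).
- case=> [h|i] [k|j] //= _; first exact: Ve.
  by have [x [y [xk yi exy]]] := Ve i k; exists y, x; rewrite edge_sym.
Qed.

(** Not all [m] cops can have strands, by [state_model]. The free cop [z] gets a set [S] that meets
    [R] and becomes a new strand, or the only one. *)
Lemma tame_advance R Sf r : 1 < m -> minor_free (complete_bipartite 3 m) G ->
  tame R Sf -> r \in R -> exists z p g S, [/\
    forall y, y \in nbrs R -> exists2 j, j != z & y \in Sf j,
    shadowing p g R S,
    exists2 x, x \in S & x \in R &
    forall R' : {set G}, conn R' -> R' \subset R -> [disjoint R' & S] ->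
      nbrs R' \subset nbrs R :|: S ->
      tame R' (fun j => if j == z then S else Sf j)].
Proof.
move=> m1 Gfree /tame_normal[I [T [A [B [a [b [st pT ends]]]]]]] rR.
have [sk cR av nb cov gd] := st.
have [z zI] : exists z, z \notin I.
  apply: contrapT => nz; apply: Gfree;
  apply: (state_model m1 st pT); last by apply/set0Pn; exists r.
  by apply/setP=> z; rewrite inE; apply/negPn/negP=> zI; apply: nz; exists z.
exists z.
have covz y : y \in nbrs R -> exists2 j, j != z & y \in Sf j.
  move=> yN; have [i iI yi] := cov y yN; exists i; last exact: gd.
  by apply: contraNneq zI => <-.
(* Without strands the boundary of [R] is empty, and [z] can occupy the vertex [r]. *)
have [I0|I0] := eqVneq I set0.
  exists (fun=> r), (fun=> 0), [set r]; split=> //.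
  - by split=> // [i|x /set1P//]; apply: legal_refl.
  - by exists r; rewrite ?inE.
  move=> R' cR' sR dR sN; apply: (@tame_path _ _ z [:: r]) => //.
  + by move=> x; rewrite inE => /eqP->; rewrite (disjointFl dR) // inE.
  + move=> x /(subsetP sN); rewrite !inE => /orP[/andP[xR eR]|//].
    by have [|i] := cov x; rewrite ?inE ?xR // I0 inE.
  + by move=> x; rewrite eqxx !inE.
have [[i [iI hl Ii]]|single] := EM (exists i,
    [/\ i \in I, head x0 (T i) = last x0 (T i) & I = [set i]]).
  have [T0 _ Tu] := skel_path sk iI; set v := head x0 (T i).
  have [/nbrsP[vR [w wR ewv]] _] := ends i iI.
  have nv x : x \in nbrs R -> x = v.
    by move=> /cov[j]; rewrite Ii => /set1P-> xi; apply: head_last_uniq.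
  have wv : w != v by apply: contraTneq wR => ->.
  (* The boundary is just [v]. The new strand is the edge from [v] to a neighbour [w] in [R]; every
     vertex other than [v] has shadow [w]. *)
  exists (fun k => if k == 0 then v else w), (fun x => (x != v) : nat), [set v; w]; split=> //.
  - split=> [[|k]|x y _ _ _|x /set2P[]->]; rewrite ?eqxx ?wv //.
    + by rewrite /legal_move /= edge_sym ewv orbT.
    + exact: legal_refl.
    + by split; [case: (x != v)|case: (y != v)].
  - by exists w; rewrite ?inE ?eqxx ?orbT.
  move=> R' cR' sR dR sN; apply: (@tame_path _ _ z [:: v; w]) => //=.
  + by rewrite edge_sym ewv.
  + by rewrite inE eq_sym wv.
  + by move=> x xQ; rewrite (disjointFl dR) //; move: xQ; rewrite !inE.
  + by move=> x /(subsetP sN)/setUP[/nv->|]; rewrite !inE ?eqxx.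
  + by move=> x; rewrite eqxx !inE.
have [||a' [b' [ab sk' [i iI hi] [j jI lj]]]] := skeleton_ends sk pT.
- exact: I0.
- by move=> i iI hl; apply/eqP=> Ii; apply: single; exists i.
have a'N : a' \in nbrs R by rewrite -hi; have [] := ends i iI.
have b'N : b' \in nbrs R by rewrite -lj; have [] := ends j jI.
have [Q [p [g [sh pQ hlQ QR [w wQ wR]]]]] := geodesic_shadowing cR a'N b'N ab.
exists p, g, [set x in Q]; split=> //; first by exists w; rewrite ?inE.
move=> R' cR' sR dR sN; have [hQ lQ] := hlQ x0.
have inN x : x \in nbrs R' -> x \in nbrs R \/ x \in Q.
  by move/(subsetP sN)/setUP=> [|]; [left|right; rewrite inE in b0].
exists (z |: I), (fun k => if k == z then Q else T k), A, B, a', b'; split=> //.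
- apply: skeleton_extend sk' ab zI _ _ pQ hQ lQ QR av; [by exists i|by exists j].
- move=> x xR'; have [xA xB xT] := av x (subsetP sR x xR'); split=> // k.
  case: eqP => [_ _|/eqP kz]; last by case/setU1P=> [kz'|/xT//]; rewrite kz' eqxx in kz.
  by have := disjointFr dR xR'; rewrite inE => ->.
- move=> x /inN[/nb//|/QR[->|->|/av[]//]]; exact: nb.
- move=> x /inN[/cov[k kI xk]|xQ]; last by exists z; rewrite ?setU11 ?eqxx.
  exists k; first by rewrite setU1r.
  by case: eqP => // kz; rewrite -kz kI in zI.
- move=> k x kI xN; case: eqP => [_|/eqP kz]; first by rewrite inE.
  case/setU1P: kI => [kz'|kI]; first by rewrite kz' eqxx in kz.
  (* A vertex of [Q] on an old strand is [a'] or [b']; both lie in [nbrs R], so the cop of that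
     strand guards it already. *)
  have [xNR|xQ] := inN x xN; first exact: gd.
  move=> xk; have [xa|xb|/av[_ _ /(_ k kI)]] := QR x xQ; last by rewrite xk.
    by apply: gd => //; rewrite xa.
  by apply: gd => //; rewrite xb.
Qed.

(** Induction on the size of [R]: once [z] guards [S], the robber is confined to its component of
    [R :\: S], which is smaller because [S] meets [R]. *)
Lemma tame_winning : 1 < m -> minor_free (complete_bipartite 3 m) G ->
  connected_graph G -> forall R Sf (c : 'I_m -> G) r, tame R Sf -> r \in R ->
  (forall j, ready (c j) r R (Sf j)) -> winning c r.
Proof.
move=> m1 Gfree cG R; have [n] := ubnP #|R|; elim: n R => // n IHn R /ltnSE leR.
move=> Sf c r tR rR rdy.
have [z [p [g [S [cov sh [x xS xR] next]]]]] := tame_advance m1 Gfree tR rR.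
apply: (acquire_guard cG rR cov _ sh) => // c' r' r'R rdy' rdyz.
have [r'S|r'S] := boolP (r' \in S); first exact: ready_capture rdyz r'S.
have [|R' [cR' r'R' sR' dR']] := @component G r' (R :\: S); first by rewrite inE r'S.
have sR : R' \subset R by apply: subset_trans sR' (subsetDl _ _).
apply: (IHn R' _ (fun j => if j == z then S else Sf j)) => //.
- apply: leq_trans leR; apply: proper_card; apply/properP; split=> //.
  by exists x => //; apply/negP=> /(subsetP sR'); rewrite inE xS.
- apply: next => //.
    by rewrite disjoint_subset; apply/subsetP=> y /(subsetP sR'); rewrite !inE => /andP[].
  apply/subsetP=> y yN; rewrite inE; have [yS|yS] := boolP (y \in S); first by rewrite orbT.
  rewrite orbF; apply/nbrsP; have := disjointFr dR' yN; rewrite inE yS /= => ->; split=> //.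
  by have /nbrsP[_ [u uR' euy]] := yN; exists u => //; apply: (subsetP sR).
- by move=> j; case: eqP => [->|/eqP jz]; apply: ready_sub sR _; last exact: rdy'.
Qed.

End Strands.

Theorem corollary5p4 (t : nat) (ht : 2 <= t) (G : sgraph)
  (Gconn : connected_graph G)
  (Gfree : minor_free (complete_bipartite 3 t) G) :
  cop_number G <= t.
Proof.
have [_ cop_min] := cop_numberP G.
have [[x0 _]|G0] := EM (exists x : G, True); last first.
  (* On the graph without vertices zero cops win, as the robber has no play. *)
  apply: (leq_trans (cop_min 0 _)) => //.
  exists (fun _ (j : 'I_0) => match notF (ltn_ord j) with end).
    by move=> r _ i [].
  by move=> r; case: G0; exists (r 0).
apply: cop_min; apply: (@winning_cops_win G t (fun=> x0)) => r.
apply: (@tame_winning G t x0 ht Gfree Gconn [set: G] (fun=> set0)) => [||j].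
(* Initially the region is the whole graph; its boundary is empty and needs no strand. *)
- exists set0, (fun=> [::]), set0, set0, x0, x0.
  split=> [||x|x|x|i x]; rewrite ?inE //; [|exact: connT].
  by split=> [||x|i|i x|i|i|i j x]; rewrite ?inE //; apply: conn0.
- by rewrite inE.
- exact: ready0.
Qed.
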